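(* Let $M$ be a delta-matroid over a finite ground set $V$, and let $v\in V$. Then the equicardinal set systems $\max(M)$, $\max(M*v)$, and $\mathrm{maxc}(M+v)$ are such that precisely two of the three are equal, to say $M_1$. Moreover, the third, $M_2$, is such that $d_{M_1}=d_{M_2}+1$ and $M_2\mathbin{\widehat{\setminus}}v=M_1$.
   Context: A set system is a pair $M=(V,D)$ with $V$ a finite set (the ground set) and $D$ a family of subsets of $V$; it is proper if $D\neq\varnothing$. We write $Y\in M$ for $Y\in D$. $\triangle$ denotes symmetric difference. A set system is equicardinal if all its sets have the same cardinality. A delta-matroid is a proper set system $M$ satisfying the symmetric exchange axiom: for all $X,Y\in M$ and all $u\in X\triangle Y$, either $X\triangle\{u\}\in M$ or there is a $w\in X\triangle Y$ with $w\neq u$ such that $X\triangle\{u,w\}\in M$. For $v\in V$: the pivot of $M$ on $v$ is $M*v=(V,\{Y\triangle\{v\}\mid Y\in D\})$; the loop complementation of $M$ on $v$ is $M+v=(V,D\triangle\{Z\cup\{v\}\mid Z\in D,\ v\notin Z\})$; the pseudo-deletion of $M$ on $v$ is $M\mathbin{\widehat{\setminus}}v=(V,\{Z\cup\{v\}\mid Z\in D,\ v\notin Z\})$ (with ground set still $V$). $\max(M)$ is the set system on $V$ consisting of the members of $D$ that are maximal with respect to inclusion; $\mathrm{maxc}(M)$ is the set system on $V$ consisting of the members of $D$ of maximum cardinality. For a proper set system $M$, $d_M=\min\{|Y|\mid Y\in M\}$ is the cardinality of a smallest set in $M$. *)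

(* Defs.v *)
From mathcomp Require Import all_boot.

Set Implicit Arguments.
Unset Strict Implicit.
Unset Printing Implicit Defensive.

(* A set system with ground set the finite type V is given by its family of
   sets, M : {set {set V}}; Leibniz equality of families is then equality of
   set systems, the ground set being shared. *)

Definition symdiff (T : finType) (A B : {set T}) : {set T} :=
  (A :\: B) :|: (B :\: A).

Section SetSystems.

Variable V : finType.
Implicit Types (M : {set {set V}}) (X Y Z : {set V}) (u v w : V).

Definition proper_system M : Prop := M != set0.

Definition equicardinal M : Prop :=
  forall X Y, X \in M -> Y \in M -> #|X| = #|Y|.

Definition delta_matroid M : Prop :=
  proper_system M /\
  forall X Y u, X \in M -> Y \in M -> u \in symdiff X Y ->
    symdiff X [set u] \in M \/
    exists w, [/\ w \in symdiff X Y, w != u & symdiff X [set u; w] \in M].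

Definition pivot M v : {set {set V}} := [set symdiff Y [set v] | Y in M].

Definition pseudo_deletion M v : {set {set V}} :=
  [set v |: Z | Z in M & v \notin Z].

Definition loop_compl M v : {set {set V}} :=
  symdiff M [set v |: Z | Z in M & v \notin Z].

Definition max_system M : {set {set V}} :=
  [set Y | maxset (fun X => X \in M) Y].

Definition maxc_system M : {set {set V}} :=
  [set Y in M | [forall Z in M, #|Z| <= #|Y|]].

(* The default value #|V| is irrelevant for proper M, as it bounds every #|Y|;
   see min_card_attained and min_card_le below. *)
Definition min_card M : nat := \big[minn/#|V|]_(Y in M) #|Y|.

Lemma min_card_le M Y : Y \in M -> min_card M <= #|Y|.
Proof.
move=> YM; rewrite /min_card; have := mem_index_enum Y.
elim: (index_enum _) => //= Z s IHs; rewrite inE big_cons.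
case/predU1P=> [<- | /IHs le]; first by rewrite ifT ?geq_minl.
by case: ifP => // _; rewrite geq_min le orbT.
Qed.

Lemma min_card_attained M :
  proper_system M -> exists2 Y, Y \in M & #|Y| = min_card M.
Proof.
case/set0Pn=> Y0 Y0M; case: (arg_minnP (fun Y => #|Y|) Y0M) => Y YM minY.
exists Y => //; apply/eqP; rewrite eqn_leq min_card_le // andbT /min_card.
by elim/big_rec: _ => [|Z n ZM le]; rewrite ?max_card // leq_min minY.
Qed.

Lemma proper_max M : proper_system M -> proper_system (max_system M).
Proof.
case/set0Pn=> Y YM; apply/set0Pn.
case: (@maxset_exists _ (fun X => X \in M) Y YM) => Z mZ _.
by exists Z; rewrite inE.
Qed.

Lemma proper_maxc M : proper_system M -> proper_system (maxc_system M).
Proof.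
case/set0Pn=> Y0 Y0M; case: (arg_maxnP (fun Y => #|Y|) Y0M) => Y YM maxY.
apply/set0Pn; exists Y; rewrite inE; apply/andP; split=> //.
by apply/forall_inP=> Z ZM; apply: maxY.
Qed.

Lemma proper_pivot M v : proper_system M -> proper_system (pivot M v).
Proof.
by case/set0Pn=> Y YM; apply/set0Pn; exists (symdiff Y [set v]); apply: imset_f.
Qed.

Lemma proper_loop_compl M v :
  proper_system M -> proper_system (loop_compl M v).
Proof.
case/set0Pn=> Y YM; apply/set0Pn.
have notP Z : v \notin Z -> Z \notin [set v |: Z | Z in M & v \notin Z].
  by move=> vZ; apply/imsetP=> -[W _ eZ]; rewrite eZ setU11 in vZ.
have [/exists_inP[Z ZM vZ] | noZ] := boolP [exists Z in M, v \notin Z].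
  by exists Z; rewrite !inE ZM notP.
exists Y; rewrite !inE YM andbT; apply/orP; left; apply/imsetP=> -[W].
by rewrite inE => /andP[WM vW] _; case/negP: noZ; apply/exists_inP; exists W.
Qed.

End SetSystems.

(* Main.v *)
(* Split the sets of M according to whether they contain v: let D0 be the
   family of sets of M avoiding v, and D1 the family of sets Z avoiding v with
   v |: Z in M.  Pivoting on v swaps D0 and D1, while loop complementation
   replaces D1 by the symmetric difference of D0 and D1.  In a delta-matroid
   every set extends to one of maximum cardinality, so max_system and
   maxc_system agree on M and on its pivot.  Let n be the largest cardinality
   in D0 and D1, and T the family of sets of cardinality n in their union.  If
   D0 and D1 both reach n, the extension property forces them to have the same
   sets of cardinality n; hence one of D0, D1 and their symmetric difference
   has no set of cardinality n, and the two others have exactly T.  These three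
   families are respectively the sets containing v, with v removed, in the
   pivot, in M and in the loop complement: the system for which this family
   misses cardinality n gives M2, whose sets avoiding v form T, and the two
   others give M1 = {v |: Z | Z in T}. *)

Require Import Defs.
From mathcomp Require Import all_boot.

Set Implicit Arguments.
Unset Strict Implicit.
Unset Printing Implicit Defensive.

Section SetSystemLemmas.

Variable V : finType.
Implicit Types (M S T : {set {set V}}) (W X Y Z : {set V}) (u v w : V).

(** * Membership in the three operations, split by whether a set contains [v] *)

Lemma in_symdiff (T : finType) (A B : {set T}) x :
  (x \in symdiff A B) = (x \in A) (+) (x \in B).
Proof. by rewrite !inE; case: (x \in A); case: (x \in B). Qed.

Lemma symdiffK (T : finType) (A B : {set T}) :
  symdiff (symdiff A B) B = A.
Proof. by apply/setP=> x; rewrite !in_symdiff addbK. Qed.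

Lemma symdiffAC (T : finType) (A B C : {set T}) :
  symdiff (symdiff A B) C = symdiff (symdiff A C) B.
Proof. by apply/setP=> x; rewrite !in_symdiff addbAC. Qed.

Lemma symdiff_set1_notin Z v : v \notin Z -> symdiff Z [set v] = v |: Z.
Proof.
move=> vZ; apply/setP=> x; rewrite in_symdiff !inE.
by case: eqVneq => [->|_]; rewrite ?(negPf vZ) ?addbF.
Qed.

Lemma symdiff_setU1 Z v : v \notin Z -> symdiff (v |: Z) [set v] = Z.
Proof. by move=> vZ; rewrite -symdiff_set1_notin ?symdiffK. Qed.

Lemma in_pivot M v X : (X \in pivot M v) = (symdiff X [set v] \in M).
Proof.
apply/imsetP/idP=> [[Y YM ->]|XM]; first by rewrite symdiffK.
by exists (symdiff X [set v]); rewrite ?symdiffK.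
Qed.

Lemma in_pivot_notin M v Z : v \notin Z -> (Z \in pivot M v) = (v |: Z \in M).
Proof. by move=> vZ; rewrite in_pivot symdiff_set1_notin. Qed.

Lemma in_pivot_setU1 M v Z : v \notin Z -> (v |: Z \in pivot M v) = (Z \in M).
Proof. by move=> vZ; rewrite in_pivot symdiff_setU1. Qed.

Lemma in_pseudo_deletion_notin M v Z :
  v \notin Z -> (Z \in pseudo_deletion M v) = false.
Proof.
by move=> vZ; apply/negP=> /imsetP[W _ eZ]; rewrite eZ setU11 in vZ.
Qed.

Lemma in_pseudo_deletion_setU1 M v Z :
  v \notin Z -> (v |: Z \in pseudo_deletion M v) = (Z \in M).
Proof.
move=> vZ; apply/imsetP/idP=> [[W]|ZM]; last by exists Z; rewrite ?inE ?ZM.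
by rewrite inE => /andP[WM vW] eZ; rewrite -(setU1K vZ) eZ setU1K.
Qed.

Lemma in_loop_compl_notin M v Z :
  v \notin Z -> (Z \in loop_compl M v) = (Z \in M).
Proof.
move=> vZ; have := in_pseudo_deletion_notin M vZ.
by rewrite /loop_compl in_symdiff /pseudo_deletion => ->; rewrite addbF.
Qed.

Lemma in_loop_compl_setU1 M v Z :
  v \notin Z -> (v |: Z \in loop_compl M v) = (v |: Z \in M) (+) (Z \in M).
Proof.
move=> vZ; have := in_pseudo_deletion_setU1 M vZ.
by rewrite /loop_compl in_symdiff /pseudo_deletion => ->.
Qed.

Lemma eq_by_notin_setU1 S S' v :
    (forall Z, v \notin Z -> (Z \in S) = (Z \in S')) ->
    (forall Z, v \notin Z -> (v |: Z \in S) = (v |: Z \in S')) ->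
  S = S'.
Proof.
move=> eq0 eq1; apply/setP=> Z; have [vZ|/eq0//] := boolP (v \in Z).
by rewrite -(setD1K vZ) eq1 ?setD11.
Qed.

(** * Sets of maximum cardinality, and extension to them in a delta-matroid *)

Lemma maxc_systemP S Y :
  reflect (Y \in S /\ forall Z, Z \in S -> #|Z| <= #|Y|) (Y \in maxc_system S).
Proof. by rewrite inE; apply: (iffP andP) => -[-> /forall_inP]. Qed.

Lemma equicardinal_maxc S : equicardinal (maxc_system S).
Proof.
move=> X Y /maxc_systemP[XS maxX] /maxc_systemP[YS maxY].
by apply/eqP; rewrite eqn_leq maxX ?maxY.
Qed.

Lemma maxc_systemE S Y n :
    Y \in S -> #|Y| = n -> (forall Z, Z \in S -> #|Z| <= n) ->
  maxc_system S = [set Z in S | #|Z| == n].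
Proof.
move=> YS <- leY; apply/setP=> Z; rewrite [RHS]inE.
apply/maxc_systemP/andP=> [[ZS maxZ]|[ZS /eqP eZ]].
  by rewrite eqn_leq leY ?maxZ.
by rewrite eZ.
Qed.

Lemma min_card_const S n :
  S != set0 -> (forall Y, Y \in S -> #|Y| = n) -> min_card S = n.
Proof. by move=> /min_card_attained[Y YS <-] ->. Qed.

(** Pivoting both sets on [v] leaves their symmetric difference unchanged, so an exchange in [M] is
    one in the pivot. *)
Lemma delta_matroid_pivot M v : delta_matroid M -> delta_matroid (pivot M v).
Proof.
move=> [propM exM]; split=> [|X Y u]; first exact: proper_pivot.
rewrite !in_pivot => XM YM.
have -> : symdiff X Y = symdiff (symdiff X [set v]) (symdiff Y [set v]).
  by apply/setP=> x; rewrite !in_symdiff addbACA addbb addbF.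
move=> uXY; case: (exM _ _ _ XM YM uXY) => [XuM|[w [wXY wu XuwM]]]; [left|right].
  by rewrite symdiffAC.
by exists w; split=> //; rewrite in_pivot symdiffAC.
Qed.

(* Among the maximum-cardinality sets, one meeting X in as many elements as
   possible must contain X, as otherwise an exchange would do better. *)
Lemma delta_matroid_extend M X :
  delta_matroid M -> X \in M -> exists2 Y, Y \in maxc_system M & X \subset Y.
Proof.
move=> [propM exM] XM; have /set0Pn[Y0 Y0M] := proper_maxc propM.
case: (arg_maxnP (fun Y => #|X :&: Y|) Y0M) => Y Ymax meetY.
exists Y => //; apply/subsetP=> u uX; apply/idPn=> uY.
have [YM maxY] := maxc_systemP _ _ Ymax.
have symE w : w != u -> w \in Y -> symdiff Y [set u; w] = u |: (Y :\ w).
  move=> wu wY; apply/setP=> x; rewrite in_symdiff !inE.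
  have [->|_] := eqVneq x u; first by rewrite (negPf uY).
  by have [->|_] := eqVneq x w; rewrite ?wY ?addbF.
have symN w : w \notin Y -> symdiff Y [set u; w] = w |: (u |: Y).
  move=> wY; apply/setP=> x; rewrite in_symdiff !inE orbCA.
  have [->|_] := eqVneq x u; first by rewrite (negPf uY).
  by have [->|_] := eqVneq x w; rewrite ?(negPf wY) ?addbF.
have uYX : u \in symdiff Y X by rewrite in_symdiff uX (negPf uY).
case: (exM _ _ _ YM XM uYX) => [YuM|[w [wYX wu YuwM]]].
  by have:= maxY _ YuM; rewrite symdiff_set1_notin // cardsU1 uY ltnn.
(* If [w] is outside [Y], the exchange enlarges [Y]; otherwise it trades [w], which is not in [X],
   for [u], keeping the cardinality and enlarging the intersection with [X]. *)
have [wY|wY] := boolP (w \in Y); last first.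
  have:= maxY _ YuwM; rewrite symN // leqNgt => /negP[].
  by rewrite !cardsU1 !inE negb_or wu wY uY ltnS leq_addl.
have wX : w \notin X by move: wYX; rewrite in_symdiff wY.
rewrite symE // in YuwM.
have cardE : #|u |: (Y :\ w)| = #|Y|.
  by rewrite cardsU1 !inE (negPf uY) andbF [RHS](cardsD1 w) wY.
have: u |: (Y :\ w) \in maxc_system M.
  by apply/maxc_systemP; rewrite cardE; split.
move=> /meetY; apply/negP; rewrite -ltnNge.
apply: proper_card; apply/properP; split; last first.
  by exists u; rewrite !inE ?uX ?eqxx // (negPf uY) andbF.
apply/subsetP=> x; rewrite !inE => /andP[xX xY]; rewrite xX xY andbT /=.
by apply/orP; right; apply: contraNneq wX => <-.
Qed.

Lemma delta_matroid_max_maxc M :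
  delta_matroid M -> max_system M = maxc_system M.
Proof.
move=> dM; apply/setP=> X; rewrite [LHS]inE.
apply/maxsetP/maxc_systemP=> -[XM maxX]; split=> //.
  have [Y Ymax sXY] := delta_matroid_extend dM XM.
  by have [YM maxY] := maxc_systemP _ _ Ymax; rewrite -(maxX Y).
by move=> Y YM sXY; apply/esym/eqP; rewrite eqEcard sXY maxX.
Qed.

(** Because of [v |: W], a maximum-cardinality [Y] containing [Z] has more than [n] elements, so it
    contains [v]; then [Y :\ v] contains [Z] and has at most [n] elements, hence equals [Z]. *)
Lemma delta_matroid_top_setU1 M v n Z W :
    delta_matroid M ->
    (forall Y, v \notin Y -> (Y \in M) || (v |: Y \in M) -> #|Y| <= n) ->
    v \notin Z -> #|Z| = n -> Z \in M ->
    v \notin W -> #|W| = n -> v |: W \in M ->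
  v |: Z \in M.
Proof.
move=> dM len vZ cZ ZM vW cW WM.
have [Y Ymax sZY] := delta_matroid_extend dM ZM.
have [YM maxY] := maxc_systemP _ _ Ymax.
have ltnY : n < #|Y| by have:= maxY _ WM; rewrite cardsU1 vW cW.
have [vY|vY] := boolP (v \in Y); last by rewrite ltnNge len ?YM in ltnY.
suff -> : Z = Y :\ v by rewrite setD1K.
apply/eqP; rewrite eqEcard subsetD1 sZY vZ cZ len ?setD11 //.
by rewrite setD1K ?YM ?orbT.
Qed.

(** * Maximum-cardinality sets read off from those of cardinality [n] after removing [v] *)

Section TopSets.

Variables (v : V) (n : nat) (T S : {set {set V}}).
Hypothesis T_top : forall Z, Z \in T -> v \notin Z /\ #|Z| = n.
Hypothesis T_neq0 : T != set0.
Hypothesis S_le :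
  forall Z, v \notin Z -> (Z \in S) || (v |: Z \in S) -> #|Z| <= n.

Lemma maxc_lift :
    (forall Z, v \notin Z -> #|Z| = n -> (v |: Z \in S) = (Z \in T)) ->
  maxc_system S = pseudo_deletion T v.
Proof.
move=> S1; have [Z0 Z0T] := set0Pn _ T_neq0; have [vZ0 cZ0] := T_top Z0T.
have Z0S : v |: Z0 \in S by rewrite S1.
rewrite (maxc_systemE (n := n.+1) Z0S) ?cardsU1 ?vZ0 ?cZ0 // => [|Z ZS].
  apply: (@eq_by_notin_setU1 _ _ v) => Z vZ; rewrite inE.
    rewrite in_pseudo_deletion_notin //; apply/negP=> /andP[ZS /eqP cZ].
    by have:= S_le vZ; rewrite ZS cZ ltnn => /(_ isT).
  rewrite in_pseudo_deletion_setU1 // cardsU1 vZ eqSS.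
  have [cZ|] := eqVneq #|Z| n; first by rewrite S1 ?andbT.
  by move=> cZ; rewrite andbF; apply/esym; apply: contra_neqF cZ => /T_top[].
have [vZ|vZ] := boolP (v \in Z); last by rewrite leqW ?S_le ?ZS.
by rewrite (cardsD1 v) vZ ltnS S_le ?setD11 // setD1K ?ZS ?orbT.
Qed.

Hypothesis S_top0 :
  forall Z, v \notin Z -> #|Z| = n -> (Z \in S) = (Z \in T).
Hypothesis S_top1 :
  forall Z, v \notin Z -> #|Z| = n -> v |: Z \notin S.

(** A set of [S] through [v] has fewer than [n] elements besides [v], so [n] bounds it too. *)
Lemma maxc_unlifted : maxc_system S = [set Z in S | #|Z| == n].
Proof.
have [Z0 Z0T] := set0Pn _ T_neq0; have [vZ0 cZ0] := T_top Z0T.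
apply: (@maxc_systemE _ Z0); rewrite ?S_top0 // => Z ZS.
have [vZ|vZ] := boolP (v \in Z); last by rewrite S_le ?ZS.
have SZ : v |: (Z :\ v) \in S by rewrite setD1K.
have vZv : v \notin Z :\ v by rewrite setD11.
rewrite (cardsD1 v) vZ ltn_neqAle S_le ?SZ ?orbT // andbT.
by apply: contraL SZ => /eqP; apply: S_top1.
Qed.

(** [maxc_system S] may also have sets through [v]; pseudo-deletion discards them, and those
    avoiding [v] form [T]. *)
Lemma pseudo_deletion_maxc :
  pseudo_deletion (maxc_system S) v = pseudo_deletion T v.
Proof.
apply: (@eq_by_notin_setU1 _ _ v) => Z vZ.
  by rewrite !in_pseudo_deletion_notin.
rewrite !in_pseudo_deletion_setU1 // maxc_unlifted inE.
have [cZ|] := eqVneq #|Z| n; first by rewrite S_top0 ?andbT.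
by move=> cZ; rewrite andbF; apply/esym; apply: contra_neqF cZ => /T_top[].
Qed.

Lemma min_card_lift : min_card (pseudo_deletion T v) = n + 1.
Proof.
have [Z0 Z0T] := set0Pn _ T_neq0; have [vZ0 cZ0] := T_top Z0T.
apply: min_card_const => [|_ /imsetP[Z /[!inE]/andP[/T_top[_ <-] vZ] ->]].
  by apply/set0Pn; exists (v |: Z0); rewrite in_pseudo_deletion_setU1.
by rewrite cardsU1 vZ addnC.
Qed.

Lemma min_card_maxc : min_card (maxc_system S) = n.
Proof.
rewrite maxc_unlifted; have [Z0 Z0T] := set0Pn _ T_neq0.
have [vZ0 cZ0] := T_top Z0T.
apply: min_card_const => [|Y /[!inE]/andP[_ /eqP//]].
by apply/set0Pn; exists Z0; rewrite inE S_top0 // Z0T cZ0 eqxx.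
Qed.

Lemma maxc_unlifted_spec :
  [/\ pseudo_deletion T v <> maxc_system S,
      min_card (pseudo_deletion T v) = min_card (maxc_system S) + 1
    & pseudo_deletion (maxc_system S) v = pseudo_deletion T v].
Proof.
split; last exact: pseudo_deletion_maxc.
  (* The two families differ because their smallest cardinalities are [n + 1] and [n]. *)
  move=> /(congr1 (@min_card V)) /eqP.
  by rewrite min_card_lift min_card_maxc addn1 (gtn_eqF (ltnSn n)).
by rewrite min_card_lift min_card_maxc.
Qed.

End TopSets.

End SetSystemLemmas.

Theorem theorem5p6 (V : finType) (M : {set {set V}}) (v : V) :
  delta_matroid M ->
  let A := max_system M in
  let B := max_system (pivot M v) in
  let C := maxc_system (loop_compl M v) in
  [/\ equicardinal A, equicardinal B & equicardinal C] /\
  exists M1 M2 : {set {set V}},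
    [\/ [/\ A = M1, B = M1 & C = M2],
        [/\ A = M1, C = M1 & B = M2]
      | [/\ B = M1, C = M1 & A = M2]] /\
    [/\ M1 <> M2,
        min_card M1 = min_card M2 + 1
      & pseudo_deletion M2 v = M1].
Proof.
move=> dM A B C; have dN := delta_matroid_pivot v dM.
rewrite {}/A {}/B {}/C !delta_matroid_max_maxc //.
split; first by split; apply: equicardinal_maxc.
pose D := [set Z : {set V} | (v \notin Z) && ((Z \in M) || (v |: Z \in M))].
have [Z0 Z0D] : exists Z, Z \in D.
  have /set0Pn[Y YM] := dM.1; exists (Y :\ v); rewrite inE setD11 /=.
  have [vY|vY] := boolP (v \in Y); first by rewrite setD1K ?YM ?orbT.
  by rewrite (setDidPl _) ?YM // disjoint_sym disjoints1.
case: (arg_maxnP (fun Z : {set V} => #|Z|) Z0D) => Z1 Z1D.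
have [n cZ1] : exists n, #|Z1| = n by exists #|Z1|.
rewrite cZ1 => maxn.
have M_le (Z : {set V}) : v \notin Z -> (Z \in M) || (v |: Z \in M) -> #|Z| <= n.
  by move=> vZ MZ; have /maxn : Z \in D by rewrite inE vZ.
have N_le (Z : {set V}) : v \notin Z ->
    (Z \in pivot M v) || (v |: Z \in pivot M v) -> #|Z| <= n.
  by move=> vZ; rewrite in_pivot_notin // in_pivot_setU1 // orbC; apply: M_le.
have L_le (Z : {set V}) : v \notin Z ->
    (Z \in loop_compl M v) || (v |: Z \in loop_compl M v) -> #|Z| <= n.
  move=> vZ; rewrite in_loop_compl_notin // in_loop_compl_setU1 // => LZ.
  by apply: M_le => //; case: (Z \in M) LZ; rewrite ?addbF.
pose T := [set Z in D | #|Z| == n].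
have T_top (Z : {set V}) : Z \in T -> v \notin Z /\ #|Z| = n.
  by rewrite !inE => /andP[/andP[-> _] /eqP].
have T_neq0 : T != set0 by apply/set0Pn; exists Z1; rewrite inE cZ1 eqxx andbT.
have in_T (Z : {set V}) : v \notin Z -> #|Z| = n ->
    (Z \in T) = (Z \in M) || (v |: Z \in M).
  by move=> vZ cZ; rewrite !inE vZ cZ eqxx andbT.
pose top0 := [exists Z : {set V}, [&& v \notin Z, #|Z| == n & Z \in M]].
pose top1 := [exists Z : {set V}, [&& v \notin Z, #|Z| == n & v |: Z \in M]].
have top0N (Z : {set V}) : ~~ top0 -> v \notin Z -> #|Z| = n -> (Z \in M) = false.
  move=> /existsPn/(_ Z) + vZ cZ; rewrite vZ cZ eqxx; apply: negPf.
have top1N (Z : {set V}) : ~~ top1 -> v \notin Z -> #|Z| = n -> (v |: Z \in M) = false.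
  move=> /existsPn/(_ Z) + vZ cZ; rewrite vZ cZ eqxx; apply: negPf.
(* This [M1] serves in all three cases; only [M2] depends on which of [top0] and [top1] hold. *)
exists (pseudo_deletion T v).
have [t1|/top1N{}top1N] := boolP top1; last first.
  exists (maxc_system M); split.
    apply: Or33; split=> //; apply: (maxc_lift T_top) => // Z vZ cZ.
      by rewrite in_pivot_setU1 // in_T // top1N ?orbF.
    by rewrite in_loop_compl_setU1 // in_T // top1N ?orbF.
  by apply: maxc_unlifted_spec T_top _ _ _ _ => // Z vZ cZ;
    rewrite ?in_T // top1N ?orbF.
have [t0|/top0N{}top0N] := boolP top0; last first.
  exists (maxc_system (pivot M v)); split.
    apply: Or32; split=> //; apply: (maxc_lift T_top) => // Z vZ cZ.
      by rewrite in_T // (top0N Z).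
    by rewrite in_loop_compl_setU1 // in_T // (top0N Z) // addbF.
  apply: maxc_unlifted_spec T_top _ _ _ _ => // Z vZ cZ.
    by rewrite in_pivot_notin // in_T // (top0N Z).
  by rewrite in_pivot_setU1 // top0N.
have [W0 /and3P[vW0 /eqP cW0 W0M]] := existsP t0.
have [W1 /and3P[vW1 /eqP cW1 W1M]] := existsP t1.
have top01 (Z : {set V}) : v \notin Z -> #|Z| = n -> (v |: Z \in M) = (Z \in M).
  move=> vZ cZ; apply/idP/idP=> ZM; last first.
    exact: (delta_matroid_top_setU1 dM M_le vZ cZ ZM vW1 cW1 W1M).
  (* The converse is the same lemma for the pivot, where the roles of [Z] and [v |: Z] are
     swapped. *)
  rewrite -(in_pivot_setU1 M vZ).
  apply: (delta_matroid_top_setU1 dN N_le vZ cZ _ vW0 cW0).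
    by rewrite in_pivot_notin.
  by rewrite in_pivot_setU1.
(* By [top01], the sets [v |: Z] with [Z] of cardinality [n] cancel in the loop complement. *)
exists (maxc_system (loop_compl M v)); split.
  apply: Or31; split=> //; apply: (maxc_lift T_top) => // Z vZ cZ.
    by rewrite in_T // top01 // orbb.
  by rewrite in_pivot_setU1 // in_T // top01 // orbb.
apply: maxc_unlifted_spec T_top _ _ _ _ => // Z vZ cZ.
  by rewrite in_loop_compl_notin // in_T // top01 // orbb.
by rewrite in_loop_compl_setU1 // top01 // addbb.
Qed.
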